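(* Let $m \ge 1$ and $n \ge m+1$ be integers. The clique number of the Johnson graph $J_n(m,m-1)$ is $$\omega(J_n(m,m-1)) = \max(m+1,\; n-m+1).$$
   Context: $[n]=\{1,2,\ldots,n\}$ and $\binom{[n]}{m}$ is the collection of all $m$-element subsets of $[n]$. The Johnson graph $J_n(m,m-1)$ is the simple undirected graph with $\binom{n}{m}$ nodes, each node $v$ labelled by a unique set $\nu(v)\in\binom{[n]}{m}$ (so $\nu$ is a bijection from nodes to $\binom{[n]}{m}$), in which distinct nodes $v_i,v_j$ are adjacent if and only if $|\nu(v_i)\cap\nu(v_j)| = m-1$. The clique number $\omega(G)$ is the number of vertices of a largest clique (complete subgraph) of $G$. *)

(* Defs.v *)
From mathcomp Require Import all_boot.

Set Implicit Arguments.
Unset Strict Implicit.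
Unset Printing Implicit Defensive.

Record sgraph := SGraph {
  vertex :> finType;
  adj : rel vertex;
  adj_sym : symmetric adj;
  adj_irrefl : irreflexive adj
}.

Definition clique (G : sgraph) (K : {set G}) : bool :=
  [forall u in K, forall v in K, (u != v) ==> adj u v].

Definition clique_number (G : sgraph) : nat :=
  \max_(K : {set G} | clique K) #|K|.

(* The set {1, ..., n} is represented by 'I_n. A node is identified with its
   label, so the labelling of nodes by m-subsets is the projection [val]. *)
Definition msubset (n m : nat) : finType := {A : {set 'I_n} | #|A| == m}.

Section Johnson.
Variables n m l : nat.

Definition johnson_adj (u v : msubset n m) : bool :=
  (u != v) && (#|val u :&: val v| == l).

Fact johnson_adj_sym : symmetric johnson_adj.
Proof. by move=> u v; rewrite /johnson_adj eq_sym setIC. Qed.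

Fact johnson_adj_irrefl : irreflexive johnson_adj.
Proof. by move=> u; rewrite /johnson_adj eqxx. Qed.

(* The graph J_n(m, l). *)
Definition johnson : sgraph := SGraph johnson_adj_sym johnson_adj_irrefl.

End Johnson.

(* Main.v *)
Require Import Defs.
From mathcomp Require Import all_boot zify.

(** Two families of [m]-sets are visibly cliques of J(n, m, m-1): the sets that
    contain a fixed set [S] of size [m - 1] (a star, with [n - m + 1] nodes), and
    the sets contained in a fixed set [U] of size [m + 1] (with [m + 1] nodes).
    This gives the lower bound.

    For the upper bound, let [A] and [B] be two distinct members of a clique, and
    put [S = A :&: B] and [U = A :|: B], of sizes [m - 1] and [m + 1]. For another
    member [C], inclusion-exclusion inside [C] gives
      [#|C :&: S| + #|C :&: U| = #|C :&: A| + #|C :&: B| = 2 * (m - 1)],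
    where the first term is at most [m - 1] and the second at most [m]; so one
    of the two is extremal, and [S \subset C] or [C \subset U]
    ([setI_sub_or_sub_setU]). The two alternatives do not mix: if [C] misses part
    of [S] and [D] leaves [U], then [C \subset U] and [D :&: U = S], so
    [C :&: D = C :&: S] is too small for [C] and [D] to be adjacent. Hence the
    whole clique lies in the star of [S] or below [U]
    ([clique_sub_star_or_below]). *)

Section FiniteSets.
Set Implicit Arguments.
Unset Strict Implicit.

Lemma exists_set_of_card (T : finType) (k : nat) :
  k <= #|T| -> exists S : {set T}, #|S| = k.
Proof.
rewrite -cardsT -bin_gt0 -cards_draws => /card_gt0P[S].
by rewrite inE => /andP[_ /eqP]; exists S.
Qed.

(** [C] meets [A :&: B] and [A :|: B] in [2 * (m - 1)] elements altogether, one
    less than the sum [(m - 1) + m] of the two upper bounds: only one of the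
    bounds can fail to be attained. *)
Lemma setI_sub_or_sub_setU (T : finType) (m : nat) (A B C : {set T}) :
    0 < m -> #|C| = m -> #|A :&: B| = m - 1 ->
    #|C :&: A| = m - 1 -> #|C :&: B| = m - 1 ->
  (A :&: B \subset C) || (C \subset A :|: B).
Proof.
move=> m_gt0 cC cAB cCA cCB.
have incl_excl : #|C :&: (A :&: B)| + #|C :&: (A :|: B)| = (m - 1) + (m - 1).
  by rewrite setIUr setIIr addnC cardsUI cCA cCB.
apply/orP; have [SC|SC] := boolP (A :&: B \subset C); [by left | right].
(* A proper part of [A :&: B] has at most [m - 2] elements, which forces the
   other term of [incl_excl] up to [m]. *)
have : C :&: (A :&: B) \proper A :&: B.
  rewrite properEneq subsetIr andbT; apply: contraNneq SC => <-.
  exact: subsetIl.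
move/proper_card; rewrite cAB => small.
have /eqP <- : C :&: (A :|: B) == C by rewrite eqEcard subsetIl cC /=; lia.
exact: subsetIr.
Qed.

End FiniteSets.

Section Johnson.
Set Implicit Arguments.
Unset Strict Implicit.
Variables n m : nat.
Implicit Types (u v w : msubset n m) (S U : {set 'I_n}) (K : {set msubset n m}).

Definition star S : {set msubset n m} := [set v : msubset n m | S \subset val v].
Definition below U : {set msubset n m} := [set v : msubset n m | val v \subset U].

Lemma card_msubset v : #|val v| = m.
Proof. exact/eqP/(valP v). Qed.

Lemma card_below U : #|below U| = 'C(#|U|, m).
Proof.
rewrite -cards_draws -(card_imset _ val_inj); apply: eq_card => A.
rewrite inE; apply/imsetP/andP => [[v]|[AU cA]].
  by rewrite inE => vU ->; split=> //; exact: (valP v).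
by exists (Sub A cA); rewrite ?inE SubK.
Qed.

(** Complementation turns the [m]-sets above [S] into the [(n - m)]-sets below
    the complement of [S]. *)
Lemma card_star S : m <= n -> #|star S| = 'C(n - #|S|, n - m).
Proof.
move=> le_mn; have cC (A : {set 'I_n}) : #|~: A| = n - #|A| by rewrite cardsCs setCK card_ord.
rewrite -cC -cards_draws.
have inj : injective (fun v => ~: val v) by move=> u v /setC_inj/val_inj.
rewrite -(card_imset _ inj); apply: eq_card => A.
rewrite inE; apply/imsetP/andP => [[v]|[AS /eqP cA]].
  by rewrite inE => Sv ->; rewrite setCS cC card_msubset eqxx.
have cA' : #|~: A| == m by rewrite cC cA subKn.
by exists (Sub (~: A) cA'); rewrite ?inE SubK ?setCK // -setCS setCK.
Qed.

Lemma cliqueP K :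
  reflect {in K &, forall u v, u != v -> #|val u :&: val v| = m - 1}
          (clique (G := johnson n m (m - 1)) K).
Proof.
apply: (iffP idP) => [cK u v uK vK uv|cK].
  move/forall_inP: cK => /(_ u uK)/forall_inP/(_ v vK)/implyP/(_ uv).
  by case/andP=> _ /eqP.
apply/forall_inP=> u uK; apply/forall_inP=> v vK; apply/implyP=> uv.
by rewrite /= /johnson_adj uv cK //=.
Qed.

Lemma card_setI_ltn u v : u != v -> #|val u :&: val v| < m.
Proof.
move=> uv; rewrite -[ltnRHS](card_msubset u); apply: proper_card.
rewrite properEneq subsetIl andbT; apply: contraNneq uv => /setIidPl uv.
by rewrite -val_eqE eqEcard uv !card_msubset leqnn.
Qed.

Lemma clique_star S :
  #|S| = m - 1 -> clique (G := johnson n m (m - 1)) (star S).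
Proof.
move=> cS; apply/cliqueP=> u v; rewrite !inE => Su Sv /card_setI_ltn.
have : #|S| <= #|val u :&: val v| by rewrite subset_leq_card // subsetI Su.
lia.
Qed.

Lemma clique_below U :
  #|U| = m + 1 -> clique (G := johnson n m (m - 1)) (below U).
Proof.
move=> cU; apply/cliqueP=> u v; rewrite !inE => uU vU /card_setI_ltn.
have : #|val u :|: val v| <= #|U| by rewrite subset_leq_card // subUset uU.
have := cardsUI (val u) (val v); rewrite !card_msubset; lia.
Qed.

(** Each member satisfies one of the two alternatives of [setI_sub_or_sub_setU];
    the point is that the same one works for all. A member [w] outside the star
    is below [U], so it could meet a member [x] not below [U] only inside
    [val x :&: U], which is [S]; adjacency would then force [S] into [w]. *)
Lemma clique_sub_star_or_below K u v :
    clique (G := johnson n m (m - 1)) K -> u \in K -> v \in K -> u != v ->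
  (K \subset star (val u :&: val v)) || (K \subset below (val u :|: val v)).
Proof.
move=> /cliqueP cK uK vK uv; have cS := cK u v uK vK uv.
have m_gt0 : 0 < m by have := card_setI_ltn uv; lia.
set S := val u :&: val v; set U := val u :|: val v.
have dich w : w \in K -> (S \subset val w) || (val w \subset U).
  move=> wK; have [->|wu] := eqVneq w u; first by rewrite subsetIl.
  have [->|wv] := eqVneq w v; first by rewrite subsetIr.
  by apply: setI_sub_or_sub_setU (card_msubset w) _ _ _ => //; exact: cK.
apply/orP; have [?|/subsetPn[w wK]] := boolP (K \subset star S); first by left.
rewrite inE => Sw; right; apply/subsetP=> x xK; rewrite inE.
apply: contraT => xU.
have wU : val w \subset U by have := dich w wK; rewrite (negbTE Sw).
have Sx : S \subset val x by have := dich x xK; rewrite (negbTE xU) orbF.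
have wx : w != x by apply: contraNneq Sw => ->.
have xUS : val x :&: U = S.
  apply/esym/eqP; rewrite eqEcard subsetI Sx cS.
  rewrite (subset_trans (subsetIl _ _) (subsetUl _ _)) /=.
  rewrite subn1 -ltnS prednK // -[ltnRHS](card_msubset x); apply: proper_card.
  by rewrite properEneq subsetIl andbT; apply: contraNneq xU => /setIidPl.
have wxS : val w :&: val x = val w :&: S.
  by rewrite -xUS setIA setIAC (setIidPl wU).
(* [val w :&: val x] has the size of [S], so it is all of [S]. *)
case/negP: Sw; suff /eqP <- : val w :&: S == S by exact: subsetIl.
by rewrite eqEcard subsetIr -wxS cS (cK w x wK xK wx) leqnn.
Qed.

End Johnson.

Theorem corollary3p5 (n m : nat) (hm : 1 <= m) (hn : m + 1 <= n) :
  clique_number (johnson n m (m - 1)) = maxn (m + 1) (n - m + 1).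
Proof.
have le_mn : m <= n by lia.
have cardU (U : {set 'I_n}) : #|U| = m + 1 -> #|below m U| = m + 1.
  by move=> cU; rewrite card_below cU addn1 binSn.
have cardS (S : {set 'I_n}) : #|S| = m - 1 -> #|star m S| = n - m + 1.
  move=> cS; rewrite card_star // cS.
  have -> : n - (m - 1) = (n - m).+1 by lia.
  by rewrite binSn addn1.
apply/eqP; rewrite eqn_leq; apply/andP; split; last first.
  rewrite geq_max; apply/andP; split.
    have [|U cU] := @exists_set_of_card 'I_n (m + 1); first by rewrite card_ord.
    rewrite -(cardU U cU).
    by apply: leq_bigmax_cond; exact: clique_below.
  have [|S cS] := @exists_set_of_card 'I_n (m - 1).
    by rewrite card_ord; lia.
  rewrite -(cardS S cS).
  by apply: leq_bigmax_cond; exact: clique_star.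
suff upper (K : {set msubset n m}) :
    clique (G := johnson n m (m - 1)) K -> #|K| <= maxn (m + 1) (n - m + 1).
  by apply/bigmax_leqP => K; exact: upper.
move=> clK.
have [|/card_gt1P[u [v [uK vK uv]]]] := leqP #|K| 1; first by lia.
have cI : #|val u :&: val v| = m - 1 by move/cliqueP: clK; apply.
have cU : #|val u :|: val v| = m + 1.
  by have := cardsUI (val u) (val v); rewrite cI !card_msubset; lia.
have /orP[/subset_leq_card|/subset_leq_card] :=
  clique_sub_star_or_below clK uK vK uv.
  by rewrite (cardS _ cI); lia.
by rewrite (cardU _ cU); lia.
Qed.
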